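(* Let $m,k$ be integers with $1\le k\le m-1$, put $q=2^m$, $Q=2^k$, $g=\gcd(m,k)$, and assume that $m/g$ is odd (equivalently $\operatorname{ord}_2(m)\le\operatorname{ord}_2(k)$). For $(\gamma,\delta)\in(\mathbb{F}_{q^2})^2\setminus\{(0,0)\}$, define $H:\mathbb{F}_{q^2}\to\mathbb{F}_{q^2}$ by \[ H(x)=\begin{cases} x^Q\overline{x}+\gamma x+\delta\overline{x}, & \text{if }\operatorname{ord}_2(m)=\operatorname{ord}_2(k),\\ x^{Q+1}+\gamma x+\delta\overline{x}, & \text{if }\operatorname{ord}_2(m)<\operatorname{ord}_2(k). \end{cases} \] Then: (1) If $\operatorname{ord}_2(m)=\operatorname{ord}_2(k)$, then $H$ is not a permutation of $\mathbb{F}_{q^2}$, unless $k=1$, $\delta=0$ and $\operatorname{ord}(\gamma^{q-1})=3$. In this exceptional case, $H$ permutes $\mathbb{F}_{q^2}$. (2) If $\operatorname{ord}_2(m)<\operatorname{ord}_2(k)$, then $H$ is not a permutation of $\mathbb{F}_{q^2}$ for every $(\gamma,\delta)\neq(0,0)$.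
   Context: For $x\in\mathbb{F}_{q^2}$, $\overline{x}=x^q$. For a positive integer $n$, $\operatorname{ord}_2(n)$ is the $2$-adic valuation of $n$. For an element of $\mathbb{F}_{q^2}^*$, $\operatorname{ord}$ (without subscript) denotes its multiplicative order. *)

(* Defs.v *)
(* MathComp *)
From HB Require Import structures.
From mathcomp Require Import all_boot all_order all_fingroup all_algebra.

Set Implicit Arguments.
Unset Strict Implicit.
Unset Printing Implicit Defensive.

Import GRing.Theory.
Local Open Scope ring_scope.

(* Order of x in the unit group; the irrelevant value for x = 0 is 1. *)
Definition mul_order (F : finFieldType) (x : F) : nat :=
  #[insubd (1%g : {unit F}) x]%g.

Definition qconj (F : finFieldType) (q : nat) (x : F) : F := x ^+ q.

(* When m / gcd(m, k) is odd, logn 2 m <= logn 2 k, so the last branch is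
   exactly the case logn 2 m < logn 2 k. *)
Definition Hmap (F : finFieldType) (m k : nat) (gamma delta x : F) : F :=
  let q := (2 ^ m)%N in
  let Q := (2 ^ k)%N in
  if logn 2 m == logn 2 k
  then x ^+ Q * qconj q x + gamma * x + delta * qconj q x
  else x ^+ Q.+1 + gamma * x + delta * qconj q x.

(* Main.v *)
(* Write q = 2^m, Q = 2^k, G = 2^g and put e = q in the case of x^Q x^q, e = 1 in
   the case of x^(Q+1).  If H is injective, then for alpha <> 0 and
   theta = (gamma alpha + delta alpha^q) / (alpha^Q alpha^e) the additive group
   { u^Q + u^e + theta s^Q : u in F_(q^2), s in F_q } does not contain 1, so some
   functional Tr(l _) vanishes on it and Tr(l) = 1.  Vanishing on the u^Q + u^e
   puts l in F_(G^2), vanishing on theta F_q puts l theta in F_q, and Tr(l) = 1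
   keeps l out of F_q.  Hence theta = 0, or w = theta^(q-1) satisfies w <> 1 and
   w^(G+1) = 1.  With v = alpha^(q-1) and N = Q - 1 or Q + 1 one has
     gamma^q v + delta^q = w (gamma + delta v) v^N,
   so eliminating w gives an identity valid for all q + 1 elements v of norm 1,
   of degree at most q after reduction by v^(q+1) = 1.  It is therefore a
   polynomial identity, and comparing coefficients leaves only the exceptional
   case. *)
Require Import Defs.
From HB Require Import structures.
From mathcomp Require Import all_boot all_order all_fingroup all_algebra.
From mathcomp Require Import cyclic finfield zify ring.

Set Implicit Arguments.
Unset Strict Implicit.
Unset Printing Implicit Defensive.

Import GRing.Theory.
Local Open Scope ring_scope.

(** By Bezout, [u * a = v * b + gcdn a b]; the exponents [p ^ (u * a)] and [p ^ (v * b)] both fix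
    [x], which leaves [p ^ gcdn a b]. *)
Lemma expr_fixed_gcd (R : pzSemiRingType) (x : R) p a b : (0 < a)%N ->
  x ^+ (p ^ a) = x -> x ^+ (p ^ b) = x -> x ^+ (p ^ gcdn a b) = x.
Proof.
move=> a0 xa xb.
have iterE c j : x ^+ (p ^ c) = x -> x ^+ (p ^ (j * c)) = x.
  by move=> xc; elim: j => [|j IHj]; rewrite ?expn0 // mulSn expnD exprM xc.
case: (egcdnP b a0) => u v uvE _.
by rewrite -{2}(iterE a u xa) uvE expnD exprM iterE.
Qed.

(** * The absolute trace and its additive character in characteristic 2 *)

Section BinaryField.

Variables (F : finFieldType) (n : nat).
Hypothesis cardF : #|F| = (2 ^ n)%N.

Lemma pchar_binary : 2 \in [pchar F].
Proof. exact: card_finPcharP cardF isT. Qed.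

Lemma exprD_binary (x y : F) j :
  (x + y) ^+ (2 ^ j) = x ^+ (2 ^ j) + y ^+ (2 ^ j).
Proof.
by apply: exprDn_pchar; rewrite pnatX (pnatE _ (isT : prime 2)) pchar_binary.
Qed.

Lemma expr_card_binary (x : F) : x ^+ (2 ^ n) = x.
Proof. by rewrite -cardF expf_card. Qed.

Definition abs_trace (x : F) : F := \sum_(i < n) x ^+ (2 ^ i).

Lemma abs_traceD x y : abs_trace (x + y) = abs_trace x + abs_trace y.
Proof. by rewrite -big_split; apply: eq_bigr => i _; rewrite exprD_binary. Qed.

Lemma abs_trace0 : abs_trace 0 = 0.
Proof. by apply: big1 => i _; rewrite expr0n expn_eq0. Qed.

Lemma abs_trace_sqr x : abs_trace x ^+ 2 = abs_trace (x ^+ 2).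
Proof.
rewrite /abs_trace (big_morph (fun z => z ^+ 2) (fun a b => exprD_binary a b 1) (expr0n _ 2)).
by apply: eq_bigr => i _; rewrite exprAC.
Qed.

(** Squaring permutes the summands [x ^+ (2 ^ i)] cyclically, since [x ^+ (2 ^ n) = x]. *)
Lemma abs_trace_frob x j : abs_trace (x ^+ (2 ^ j)) = abs_trace x.
Proof.
elim: j => [|j IHj]; rewrite ?expr1 // expnSr exprM -{}IHj.
move: (x ^+ _) => y; have := expr_card_binary y; rewrite /abs_trace.
case: (n) => [|n'] yn; first by rewrite !big_ord0.
rewrite big_ord_recr big_ord_recl /= expr1 -exprM -expnS yn addrC.
by congr (_ + _); apply: eq_bigr => i _; rewrite -exprM -expnS.
Qed.

Lemma abs_trace01 x : abs_trace x != 0 -> abs_trace x = 1.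
Proof.
move=> tx0; apply: (mulfI tx0); rewrite mulr1 -expr2 abs_trace_sqr.
exact: (abs_trace_frob x 1).
Qed.

(** As a polynomial the trace has degree [2 ^ n.-1], so it cannot vanish at all [2 ^ n] elements. *)
Lemma abs_trace_neq0 : exists x, abs_trace x != 0.
Proof.
apply/existsP; apply: contraT; rewrite negb_exists => /forallP tr0.
have n0 : (0 < n)%N by move: (finNzRing_gt1 F); rewrite cardF; case: (n).
pose p : {poly F} := \sum_(i < n) 'X^(2 ^ i).
have sp : size p = (2 ^ n.-1).+1.
  rewrite /p; case: (n) n0 => // n' _.
  rewrite big_ord_recr /= addrC size_polyDl size_polyXn //= ltnS.
  apply: leq_trans (size_sum _ _ _) _; apply/bigmax_leqP => i _.
  by rewrite size_polyXn ltn_exp2l.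
have p0 : p != 0 by rewrite -size_poly_eq0 sp.
have := max_poly_roots p0 (_ : all (root p) (enum F)) (enum_uniq F).
rewrite -cardE cardF sp ltnS leq_exp2l // leqNgt prednK // leqnn.
apply; apply/allP => x _; rewrite /root horner_sum.
by have := tr0 x; rewrite negbK; under eq_bigr do rewrite hornerXn.
Qed.

Lemma abs_trace_nondegenerate x : (forall u, abs_trace (x * u) = 0) -> x = 0.
Proof.
move=> xu; have [y y0] := abs_trace_neq0; apply: contraNeq y0 => x0.
by rewrite -(mulVKf x0 y) xu.
Qed.

(** The additive character (-1)^Tr, with values in [int] so that character sums can be tested for
    positivity. *)
Definition trace_sign (x : F) : int := if abs_trace x == 0 then 1 else -1.

Lemma trace_signD x y : trace_sign (x + y) = trace_sign x * trace_sign y.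
Proof.
rewrite /trace_sign abs_traceD.
have [->|/abs_trace01->] := eqVneq (abs_trace x) 0; first by rewrite add0r mul1r.
have [->|/abs_trace01->] := eqVneq (abs_trace y) 0.
  by rewrite addr0 oner_eq0 mulr1.
by rewrite addrr_pchar2 ?pchar_binary // eqxx mulrNN.
Qed.

(** Translating the index by [t0] flips every sign, so the sum equals its opposite. *)
Lemma sum_trace_sign (T : finZmodType) (f : T -> F) t0 :
  {morph f : s t / s + t} -> abs_trace (f t0) != 0 ->
  \sum_t trace_sign (f t) = 0.
Proof.
move=> fD /negbTE t0N; set S := \sum_t _.
have: S = - S.
  rewrite {1}/S (reindex_inj (addIr t0)) /= -mulrN1 big_distrl /=.
  by apply: eq_bigr => t _; rewrite fD trace_signD {2}/trace_sign t0N.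
lia.
Qed.

(* Double counting of [\sum_(l, t) (-1)^Tr(l (f t + 1))]: summing over [l] first
   gives 0, while summing over [t] first leaves only the [l] orthogonal to the
   image of [f], among them [l = 0]. *)
Lemma trace_separation (T : finZmodType) (f : T -> F) :
  {morph f : s t / s + t} -> (forall t, f t != 1) ->
  exists2 l, (forall t, abs_trace (l * f t) = 0) & abs_trace l = 1.
Proof.
move=> fD f1.
case: (pickP (fun l => [forall t, abs_trace (l * f t) == 0] && (abs_trace l != 0))).
  by move=> l /andP[/forallP lf /abs_trace01 l1]; exists l => // t; apply/eqP.
move=> none; pose S : int := \sum_l \sum_t trace_sign (l * (f t + 1)).
have S0 : S = 0.
  rewrite /S exchange_big big1 // => t _ /=.
  have ft1 : f t + 1 != 0.
    by rewrite -(oppr_pchar2 pchar_binary 1) subr_eq0 f1.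
  have [y y0] := abs_trace_neq0.
  apply: (sum_trace_sign (t0 := y / (f t + 1))); last by rewrite divfK.
  by move=> a b; rewrite mulrDl.
have : 0 < S; last by rewrite S0.
(* By [none], an [l] orthogonal to the image of [f] has trace 0, so all its terms are 1; for any
   other [l] the signs cancel. *)
have termE l : \sum_t trace_sign (l * (f t + 1)) =
    if [forall t, abs_trace (l * f t) == 0] then #|T|%:R else 0.
  case: ifP => [lf|/forallPn[t0 t0N]].
    have := none l; rewrite lf /= => /negbFE/eqP l0.
    rewrite -sum1_card natr_sum; apply: eq_bigr => t _.
    by rewrite mulrDr mulr1 /trace_sign abs_traceD l0 (eqP (forallP lf t)) addr0 eqxx.
  under eq_bigr do rewrite mulrDr trace_signD.
  rewrite -big_distrl /= (sum_trace_sign (f := fun t => l * f t) _ t0N) ?mul0r //.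
  by move=> s t; rewrite fD mulrDr.
rewrite /S (bigD1 0) //= termE; case: ifPn; last first.
  by case/forallPn => t; rewrite mul0r abs_trace0 eqxx.
move=> _; apply: Num.Theory.ltr_wpDr.
  by apply: Num.Theory.sumr_ge0 => l _; rewrite termE; case: ifP.
by rewrite Num.Theory.ltr0n; apply/card_gt0P; exists 0.
Qed.

End BinaryField.

(* MathComp does not join the [finType] and [zmodType] structures of products. *)
HB.saturate prod.

(** * Conjugation and trace duality in the field of order q^2 *)

Section QuadraticExtension.

Variables (F : finFieldType) (m : nat).
Hypothesis cardF : #|F| = (2 ^ (m * 2))%N.

Let charF2 : 2 \in [pchar F]. Proof. exact: pchar_binary cardF. Qed.

Lemma conjqK (x : F) : (x ^+ (2 ^ m)) ^+ (2 ^ m) = x.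
Proof. by rewrite -exprM -expnD addnn -muln2 (expr_card_binary cardF). Qed.

Lemma ext_degree_gt0 : (0 < m)%N.
Proof. by move: (finNzRing_gt1 F); rewrite cardF; case: (m). Qed.

(** The conjugates of index [i] and [m + i] coincide, so the sum cancels in pairs. *)
Lemma abs_trace_subfield (x : F) :
  x ^+ (2 ^ m) = x -> abs_trace (m * 2) x = 0.
Proof.
move=> xq; rewrite muln2 -addnn /abs_trace big_split_ord /=.
under [X in _ + X]eq_bigr do rewrite expnD exprM xq.
exact: addrr_pchar2.
Qed.

(** Under the trace form, the adjoint of a Frobenius power is its inverse, written with exponent
    [m * 2 - k]. *)
Lemma abs_trace_shift (l u : F) k : (k <= m * 2)%N ->
  abs_trace (m * 2) (l * u ^+ (2 ^ k)) =
  abs_trace (m * 2) (l ^+ (2 ^ (m * 2 - k)) * u).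
Proof.
move=> kn; rewrite -(abs_trace_frob cardF _ (m * 2 - k)) exprMn -exprM -expnD.
by rewrite subnKC // (expr_card_binary cardF).
Qed.

(** Passing to adjoints, nondegeneracy makes the inverse Frobenius powers of index [k] and [j] agree
    on [l]. *)
Lemma trace_orthogonal_frob (l : F) k j : (k <= m * 2)%N -> (j <= m * 2)%N ->
  (forall u, abs_trace (m * 2) (l * (u ^+ (2 ^ k) + u ^+ (2 ^ j))) = 0) ->
  l ^+ (2 ^ (m * 2 - j + k)) = l.
Proof.
move=> kn jn lu.
have /eqP : l ^+ (2 ^ (m * 2 - k)) + l ^+ (2 ^ (m * 2 - j)) = 0.
  apply: (abs_trace_nondegenerate cardF) => u.
  by rewrite mulrDl (abs_traceD cardF) // -!abs_trace_shift // -(abs_traceD cardF) // -mulrDr lu.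
rewrite -GRing.subr_pchar2 // subr_eq0 => /eqP ljk.
by rewrite expnD exprM -ljk -exprM -expnD subnK // (expr_card_binary cardF).
Qed.

(* [l] is fixed by the Frobenius [2 ^ (2 g)], so [l ^+ (q - 1)] has order
   dividing [2 ^ g + 1]. *)
Lemma expr_norm1_order (l : F) g : (g %| m)%N -> l != 0 ->
  l ^+ (2 ^ (g * 2)) = l -> l ^+ ((2 ^ m - 1) * (2 ^ g + 1)) = 1.
Proof.
move=> gm l0 lg.
have l1 : l ^+ ((2 ^ g - 1) * (2 ^ g + 1)) = 1.
  apply: (mulfI l0); rewrite mulr1 -exprS -[RHS]lg expnM; congr (_ ^+ _).
  by have := expn_gt0 2 g; nia.
have /dvdnP[c ->] : (2 ^ g - 1 %| 2 ^ m - 1)%N.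
  case/dvdnP: gm => c ->; rewrite mulnC expnM -[X in (_ %| _ - X)%N](exp1n c).
  by rewrite !subn_exp dvdn_mulr.
by rewrite -mulnA mulnC exprM l1 expr1n.
Qed.

(** * Consequences of injectivity for the ratio [theta] *)

Lemma separated_ratio (theta : F) k j g : (k <= m * 2)%N -> (j <= m * 2)%N ->
  (g %| m)%N -> gcdn (m * 2 - j + k) (m * 2) = (g * 2)%N ->
  (forall u s, s ^+ (2 ^ m) = s ->
     u ^+ (2 ^ k) + u ^+ (2 ^ j) + theta * s ^+ (2 ^ k) != 1) ->
  theta != 0 ->
  theta ^+ (2 ^ m - 1) != 1 /\
  theta ^+ ((2 ^ m - 1) * (2 ^ g + 1)) = 1.
Proof.
move=> kn jn gm gcdE sep th0.
(* Writing [s] as a relative trace r + r^q makes the domain a full product group and puts [s] in the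
   subfield of order q. *)
pose f (p : F * F) := p.1 ^+ (2 ^ k) + p.1 ^+ (2 ^ j) +
  theta * (p.2 + p.2 ^+ (2 ^ m)) ^+ (2 ^ k).
have fD : {morph f : s t / s + t}.
  by move=> [a b] [c d]; rewrite /f /= !(exprD_binary cardF); ring.
have [|l lf l1] := trace_separation (T := (F * F)%type) cardF fD.
  move=> [u r]; apply: sep; rewrite (exprD_binary cardF) conjqK addrC //.
have lg : l ^+ (2 ^ (g * 2)) = l.
  rewrite -gcdE gcdnC; apply: expr_fixed_gcd.
  - by rewrite muln_gt0 ext_degree_gt0.
  - exact: expr_card_binary cardF _.
  - apply: trace_orthogonal_frob => // u; have := lf (u, 0).
    by rewrite /f /= expr0n expn_eq0 add0r expr0n expn_eq0 mulr0 addr0.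
have lth : (l * theta) ^+ (2 ^ m) = l * theta.
  apply/eqP; rewrite eq_sym -subr_eq0 GRing.subr_pchar2 //; apply/eqP.
  apply: (abs_trace_nondegenerate cardF) => y.
  have -> : (l * theta) ^+ (2 ^ m) = (l * theta) ^+ (2 ^ (m * 2 - m)).
    by congr (_ ^+ (2 ^ _)); lia.
  rewrite mulrDl (abs_traceD cardF) -abs_trace_shift -?(abs_traceD cardF); last lia.
  (* The second component is the [2 ^ k]-th root of [y], so this reads Tr(l theta (y + y^q)) = 0. *)
  have := lf (0, y ^+ (2 ^ (m * 2 - k))).
  rewrite /f /= !expr0n !expn_eq0 /= !add0r (exprD_binary cardF).
  rewrite [_ ^+ (2 ^ m) ^+ _]exprAC -[y ^+ _ ^+ (2 ^ k)]exprM -expnD subnK //.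
  by rewrite (expr_card_binary cardF) mulrA mulrDr.
have l0 : l != 0.
  by apply: contra_eq_neq l1 => ->; rewrite abs_trace0 // eq_sym oner_eq0.
have q1 (x : F) : x != 0 -> x ^+ (2 ^ m) = x -> x ^+ (2 ^ m - 1) = 1.
  move=> x0 xq; apply: (mulfI x0).
  by rewrite mulr1 -exprS -subSn ?expn_gt0 // subn1.
have thl : theta ^+ (2 ^ m - 1) * l ^+ (2 ^ m - 1) = 1.
  by rewrite -exprMn mulrC q1 ?mulf_neq0.
split; last first.
  have := congr1 (fun z => z ^+ (2 ^ g + 1)) thl.
  by rewrite /= exprMn expr1n -!exprM (@expr_norm1_order l) // mulr1.
(* If theta^(q-1) = 1, then [l] lies in the subfield of order q and has trace 0. *)
apply: contra_eq_neq l1 => th1; rewrite th1 mul1r in thl.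
rewrite abs_trace_subfield 1?eq_sym ?oner_eq0 //.
by rewrite -[in LHS](@subnK 1 (2 ^ m)) ?expn_gt0 // exprD thl mul1r.
Qed.

(* Iterating [y ^ (2 ^ h) = y + 1] an odd number [m / g] of times gives
   [y = y + 1], as [2 m] divides [h (m / g)]. *)
Lemma frob_sum_neq1 (u : F) k j g : (j <= m * 2)%N -> (g %| m)%N ->
  odd (m %/ g) -> gcdn (m * 2 - j + k) (m * 2) = (g * 2)%N ->
  u ^+ (2 ^ k) + u ^+ (2 ^ j) != 1.
Proof.
move=> jn gm godd gcdE; apply/eqP; set y := u ^+ (2 ^ j); set h := (_ + k)%N in gcdE.
have -> : u ^+ (2 ^ k) = y ^+ (2 ^ h).
  rewrite -exprM -expnD /h addnA subnKC // expnD exprM.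
  by rewrite (expr_card_binary cardF).
move=> /(canRL (addrK y)); rewrite GRing.subr_pchar2 // addrC => yh.
have iterE i : y ^+ (2 ^ (h * i)) = y + i%:R.
  elim: i => [|i IHi]; first by rewrite muln0 expr1 addr0.
  rewrite mulnS expnD exprM yh (exprD_binary cardF) IHi expr1n -addrA.
  by rewrite -natr1; ring.
have /dvdnP[c hE] : (m * 2 %| h * (m %/ g))%N.
  case/dvdnP: gm gcdE => c -> gcdE.
  have : (g * 2 %| h)%N by rewrite -gcdE dvdn_gcdl.
  case: (posnP g) => [->|g0]; first by rewrite muln0 div0n muln0 dvdn0.
  by case/dvdnP => d ->; rewrite mulnK //; apply/dvdnP; exists d; lia.
have := iterE (m %/ g)%N; rewrite hE.
have -> : y ^+ (2 ^ (c * (m * 2))) = y.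
  elim: (c) => [|c' IHc]; first by rewrite expr1.
  by rewrite mulSn expnD exprM (expr_card_binary cardF).
rewrite -[X in X = _]addr0 => /addrI/esym/eqP.
by rewrite -(dvdn_pcharf charF2) dvdn2 godd.
Qed.


(* For [H (x) = x^Q x^e + gamma x + delta x^q] with [e = 2 ^ j], take
   [x = u alpha / s], [a = alpha / s] with [s] in the subfield of order [q]: then
   [H (x + a) = H (x)] reads [u^Q + u^e + theta s^Q = 1], where
   [theta = (gamma alpha + delta alpha^q) / (alpha^Q alpha^e)]. *)
Lemma injective_ratio (gamma delta : F) k j g : (k <= m * 2)%N ->
  (j <= m * 2)%N -> (g %| m)%N -> odd (m %/ g) ->
  gcdn (m * 2 - j + k) (m * 2) = (g * 2)%N ->
  (forall s : F, s ^+ (2 ^ m) = s -> s ^+ (2 ^ j) = s) ->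
  injective (fun x : F =>
    x ^+ (2 ^ k) * x ^+ (2 ^ j) + gamma * x + delta * x ^+ (2 ^ m)) ->
  forall alpha : F, alpha != 0 ->
  let theta := (gamma * alpha + delta * alpha ^+ (2 ^ m)) /
               (alpha ^+ (2 ^ k) * alpha ^+ (2 ^ j)) in
  theta != 0 ->
  theta ^+ (2 ^ m - 1) != 1 /\ theta ^+ ((2 ^ m - 1) * (2 ^ g + 1)) = 1.
Proof.
move=> kn jn gm godd gcdE sj injH alpha al0 theta.
apply: (separated_ratio kn jn gm gcdE) => u s sq.
(* The substitution divides by [s], so [s = 0] is treated apart. *)
have [->|s0] := eqVneq s 0.
  by rewrite expr0n expn_eq0 mulr0 addr0 (frob_sum_neq1 _ jn gm godd gcdE).
apply/eqP => H1.
have a0 : alpha / s != 0 by rewrite mulf_neq0 ?invr_eq0.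
have D0 : alpha ^+ (2 ^ k) * alpha ^+ (2 ^ j) != 0 by rewrite mulf_neq0 ?expf_neq0.
have thD : gamma * alpha + delta * alpha ^+ (2 ^ m) =
    theta * (alpha ^+ (2 ^ k) * alpha ^+ (2 ^ j)) by rewrite divfK.
suff /injH/eqP : (alpha / s * u + alpha / s) ^+ (2 ^ k) *
    (alpha / s * u + alpha / s) ^+ (2 ^ j) + gamma * (alpha / s * u + alpha / s) +
    delta * (alpha / s * u + alpha / s) ^+ (2 ^ m) =
  (alpha / s * u) ^+ (2 ^ k) * (alpha / s * u) ^+ (2 ^ j) +
    gamma * (alpha / s * u) + delta * (alpha / s * u) ^+ (2 ^ m).
  by rewrite -subr_eq0 addrAC subrr add0r (negbTE a0).
rewrite !(exprD_binary cardF) !exprMn !exprVn sq (sj s sq).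
have sk0 : s ^+ (2 ^ k) != 0 by rewrite expf_neq0.
move: sk0 thD H1; set S := s ^+ (2 ^ k); set U := u ^+ (2 ^ k).
set V := u ^+ (2 ^ j); set A := alpha ^+ (2 ^ k); set B := alpha ^+ (2 ^ j).
set W := u ^+ (2 ^ m); set C := alpha ^+ (2 ^ m) => sk0 thD H1.
have two0 : 1 + 1 = 0 :> F by rewrite addrr_pchar2.
apply/eqP; rewrite -subr_eq0; apply/eqP.
(* The summand [1 + 1] makes this an identity over any field; it vanishes in characteristic 2. *)
transitivity ((A * B / (S * s) * (U + V + theta * S - 1 + (1 + 1))) +
  (gamma * alpha + delta * C - theta * (A * B)) / s); last first.
  by rewrite H1 subrr two0 thD subrr add0r mulr0 mul0r addr0.
by field; rewrite s0 sk0.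
Qed.

(** Conjugating the definition of [theta] gives r = theta^(q-1) p, without division by [p], so
    [theta = 0] is covered. The implication records theta^(q-1) != 1 and later allows cancelling
    [p + r]. *)
Lemma norm1_relation (gamma delta : F) k j g : (k <= m * 2)%N ->
  (j <= m * 2)%N -> (g %| m)%N -> odd (m %/ g) ->
  gcdn (m * 2 - j + k) (m * 2) = (g * 2)%N ->
  (forall s : F, s ^+ (2 ^ m) = s -> s ^+ (2 ^ j) = s) ->
  injective (fun x : F =>
    x ^+ (2 ^ k) * x ^+ (2 ^ j) + gamma * x + delta * x ^+ (2 ^ m)) ->
  forall alpha : F, alpha != 0 ->
  let v := alpha ^+ (2 ^ m - 1) in
  let p := (gamma + delta * v) * (v ^+ (2 ^ k) * v ^+ (2 ^ j)) in
  let r := gamma ^+ (2 ^ m) * v + delta ^+ (2 ^ m) in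
  (p = r -> p = 0) /\ r ^+ (2 ^ g + 1) = p ^+ (2 ^ g + 1).
Proof.
move=> kn jn gm godd gcdE sj injH alpha al0 v p r.
have := injective_ratio kn jn gm godd gcdE sj injH al0.
set theta := _ / _ => /= thP.
have alq : alpha ^+ (2 ^ m) = alpha * v.
  by rewrite -exprS -subSn ?expn_gt0 // subn1.
have D0 : alpha ^+ (2 ^ k) * alpha ^+ (2 ^ j) != 0 by rewrite mulf_neq0 ?expf_neq0.
have thD : alpha * (gamma + delta * v) =
    theta * (alpha ^+ (2 ^ k) * alpha ^+ (2 ^ j)).
  by rewrite divfK // alq; ring.
have rE : alpha * r = theta ^+ (2 ^ m) * (alpha ^+ (2 ^ k) * alpha ^+ (2 ^ j)) *
    (v ^+ (2 ^ k) * v ^+ (2 ^ j)).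
  have -> : alpha * r = (alpha * (gamma + delta * v)) ^+ (2 ^ m).
    have -> : alpha * (gamma + delta * v) = gamma * alpha + delta * alpha ^+ (2 ^ m).
      by rewrite alq; ring.
    by rewrite (exprD_binary cardF) !exprMn conjqK alq /r; ring.
  by rewrite thD !exprMn ![alpha ^+ _ ^+ (2 ^ m)]exprAC alq !exprMn; ring.
have wE : r = theta ^+ (2 ^ m - 1) * p.
  have thq : theta ^+ (2 ^ m) = theta ^+ (2 ^ m - 1) * theta.
    by rewrite -exprSr -subSn ?expn_gt0 // subn1.
  by apply: (mulfI al0); rewrite rE thq -[_ * theta * _]mulrA -thD /p; ring.
have [th0|/thP[w1 wG]] := eqVneq theta 0.
  have p0 : p = 0.
    have /eqP := thD; rewrite th0 mul0r mulf_eq0 (negbTE al0) => /eqP vE.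
    by rewrite /p vE mul0r.
  by rewrite wE p0 mulr0.
split; last by rewrite wE exprMn -exprM wG mul1r.
rewrite wE => /eqP; rewrite -subr_eq0 -{1}[p]mul1r -mulrBl mulf_eq0 subr_eq0.
by rewrite eq_sym (negbTE w1) => /eqP.
Qed.

(* The [alpha ^+ (q - 1)] are the [q + 1] elements of norm 1; composing with
   ['X^(q - 1)] avoids enumerating them. *)
Lemma norm1_poly_eq0 (p : {poly F}) : (size p <= 2 ^ m + 1)%N ->
  (forall alpha : F, alpha != 0 -> p.[alpha ^+ (2 ^ m - 1)] = 0) -> p = 0.
Proof.
move=> sp p0; have q2 : (1 < 2 ^ m)%N by rewrite -{1}(expn0 2) ltn_exp2l ?ext_degree_gt0.
have sX : size ('X^(2 ^ m - 1) : {poly F}) = (2 ^ m - 1).+1 by rewrite size_polyXn.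
apply/eqP; rewrite -(comp_poly_eq0 p (q := 'X^(2 ^ m - 1))); last by rewrite sX; lia.
apply: contraT => cp0.
have roots : all (root (p \Po 'X^(2 ^ m - 1))) (enum (predC1 (0 : F))).
  apply/allP => x; rewrite mem_enum /= => x0.
  by rewrite /root horner_comp hornerXn p0.
(* The composite has degree at most q (q - 1), less than the number q^2 - 1 of nonzero elements. *)
have := max_poly_roots cp0 roots (enum_uniq _).
rewrite -cardE cardC1 cardF ltnNge => /negP[].
have := size_comp_poly p 'X^(2 ^ m - 1); rewrite sX expnM /= => sE.
move: sE sp q2; move: (size (p \Po _)) (size p) => c d.
by move: (2 ^ m)%N => q; case: d => [|d] /=; nia.
Qed.


(** * Degree bounds and comparison of coefficients *)

Lemma size_poly_linear (a b : F) : (size (a%:P * 'X + b%:P)%R <= 2)%N.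
Proof. by rewrite size_MXaddC; case: ifP => // _; rewrite ltnS size_polyC_leq1. Qed.

Lemma size_exp_leq (p : {poly F}) d n :
  (size p <= d.+1)%N -> (size (p ^+ n)%R <= (d * n).+1)%N.
Proof.
move=> sp; apply: leq_trans (size_poly_exp_leq _ _) _.
by rewrite ltnS leq_mul // -subn1 leq_subLR add1n.
Qed.

Lemma size_mul_leq (p q : {poly F}) d e : (size p <= d.+1)%N ->
  (size q <= e.+1)%N -> (size (p * q)%R <= (d + e).+1)%N.
Proof. by move=> sp sq; apply: leq_trans (size_polyMleq _ _) _; lia. Qed.

Lemma size_add_leq (p q : {poly F}) d :
  (size p <= d)%N -> (size q <= d)%N -> (size (p + q)%R <= d)%N.
Proof. by move=> sp sq; rewrite (leq_trans (size_polyD _ _)) // geq_max sp. Qed.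

(** Both sides have degree at most [n + M <= 2 ^ m], so they agree as polynomials; the value at 0
    yields [b = 0], the coefficient of X^M the rest. *)
Lemma norm1_power_relation (a b c d : F) n M : (0 < n)%N -> (0 < M)%N ->
  (n + M <= 2 ^ m)%N ->
  (forall alpha : F, alpha != 0 -> let v := alpha ^+ (2 ^ m - 1) in
     (a * v + b) ^+ M = v ^+ n * (d * v + c) ^+ M) ->
  b = 0 /\ (d = 0 -> a != 0 -> n = M).
Proof.
move=> n0 M0 nM vE.
have /eqP : (a%:P * 'X + b%:P) ^+ M - 'X^n * (d%:P * 'X + c%:P) ^+ M = 0.
  apply: norm1_poly_eq0 => [|alpha al0]; last first.
    by rewrite !hornerE vE // subrr.
  rewrite addn1; apply: size_add_leq; rewrite ?size_polyN.
    apply: leq_trans (size_exp_leq _ (size_poly_linear a b)) _; lia.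
  apply: leq_trans (size_mul_leq (d := n) _ (size_exp_leq _ (size_poly_linear d c))) _.
    by rewrite size_polyXn.
  lia.
rewrite subr_eq0 => /eqP PE; have b0 : b = 0.
  have := congr1 (horner^~ 0) PE; rewrite !hornerE expr0n.
  by rewrite [n == _]eqn0Ngt n0 mul0r => /eqP; rewrite expf_eq0 M0 => /eqP.
split=> // d0 a0; have := congr1 (fun p : {poly F} => p`_M) PE.
rewrite b0 d0 mul0r add0r addr0 exprMn -!rmorphXn /= mulrC coefMC coefXn eqxx.
rewrite mul1r coefMC coefXn.
case: (eqVneq M n) => [->//|_] /eqP.
by rewrite mul0r expf_eq0 (negbTE a0) andbF.
Qed.

(* The polynomial is [p^G + r (p + r)^(G - 1)] with [p = (c + d X) X^(Q + 1)]
   and [r = a X + b], reduced by [X^(Q G + 1) = 1]. *)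
Lemma norm1_reduced_relation (a b c d : F) Q g : (0 < g)%N ->
  let G := (2 ^ g)%N in
  ((Q + 2) * (G - 1) + 1 <= 2 ^ m)%N ->
  (forall alpha : F, alpha != 0 -> let v := alpha ^+ (2 ^ m - 1) in
     (d ^+ G * v ^+ G + c ^+ G) * v ^+ (G - 1) +
     (a * v + b) * ((c + d * v) * v ^+ Q.+1 + (a * v + b)) ^+ (G - 1) = 0) ->
  b = 0 /\ (d = 0 -> c = 0).
Proof.
move=> g0 G; have G2 : (1 < G)%N by rewrite -(expn0 2) ltn_exp2l.
move=> sG vE; have PE :
  ((d ^+ G)%:P * 'X^G + (c ^+ G)%:P) * 'X^(G - 1) +
  (a%:P * 'X + b%:P) *
  ((c%:P + d%:P * 'X) * 'X^(Q.+1) + (a%:P * 'X + b%:P)) ^+ (G - 1) = 0.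
  apply: norm1_poly_eq0 => [|alpha al0]; last first.
    by rewrite -[RHS](vE _ al0) /= !hornerE.
  have sq := size_poly_linear.
  rewrite addn1; apply: size_add_leq.
    apply: leq_trans (size_mul_leq (d := G) (e := G - 1) _ _) _.
    - apply: size_add_leq; last by rewrite (leq_trans (size_polyC_leq1 _)).
      apply: leq_trans (size_mul_leq (d := 0) (e := G) _ _) _ => //.
        exact: size_polyC_leq1.
      by rewrite size_polyXn.
    - by rewrite size_polyXn.
    - by nia.
  apply: leq_trans (size_mul_leq (sq a b) (size_exp_leq (d := Q + 2) _ _)) _.
    apply: size_add_leq; last by rewrite (leq_trans (sq a b)) // addn2.
    rewrite [_ + d%:P * 'X]addrC.
    apply: leq_trans (size_mul_leq (e := Q.+1) (sq d c) _) _.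
      by rewrite size_polyXn.
    by rewrite addn2.
  by nia.
have b0 : b = 0.
  have := congr1 (horner^~ 0) PE; rewrite !hornerE !expr0n.
  rewrite subn_eq0 leqNgt G2 /= !mulr0 !add0r => /eqP.
  by rewrite mulf_eq0 expf_eq0 => /orP[/eqP//|/andP[_ /eqP]].
split=> // d0; have := PE; rewrite b0 d0 !polyC0 expr0n.
have -> : (G == 0)%N = false by lia.
rewrite !mul0r !addr0 add0r => PE'.
(* Once X^(G-1) is cancelled, the value at 0 is c^G. *)
have : 'X^(G - 1) * ((c ^+ G)%:P + a%:P * 'X * (c%:P * 'X^Q + a%:P) ^+ (G - 1)) = 0.
  rewrite -[RHS]PE' mulrDr; congr (_ + _); first exact: mulrC.
  by rewrite mulrCA -exprMn exprSr; congr (_ * _ ^+ _); ring.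
move=> /eqP; rewrite mulf_eq0 -size_poly_eq0 size_polyXn /= => /eqP.
move=> /(congr1 (horner^~ 0)); rewrite !hornerE => /eqP.
by rewrite expf_eq0 => /andP[_ /eqP].
Qed.


(* With [l = w^2], [w = gamma^(q - 1)] a primitive cube root of unity, the
   functional [Tr(l _)] kills [u^2 + u^q] and [gamma / (a a^q)] but not 1. *)
Lemma cubic_exceptional_injective (gamma : F) : odd m ->
  gamma ^+ (2 ^ m - 1) != 1 -> gamma ^+ ((2 ^ m - 1) * 3) = 1 ->
  injective (fun x : F => x ^+ 2 * x ^+ (2 ^ m) + gamma * x).
Proof.
rewrite exprM; move wE : (gamma ^+ _) => w modd w1 w3 x y /= Hxy.
apply/eqP; rewrite eq_sym -subr_eq0; apply: contraT.
move aE : (y - x) => a a0; move uE : (x / a) => u; pose N := a * a ^+ (2 ^ m).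
have N0 : N != 0 by rewrite mulf_neq0 ?expf_neq0.
(* This is H(y) = H(x) with x = a u and y = a u + a, divided by a^2 a^q. *)
have relation : u ^+ 2 + u ^+ (2 ^ m) + (1 + gamma / N) = 0.
  have a30 : a ^+ 2 * a ^+ (2 ^ m) != 0 by rewrite mulf_neq0 ?expf_neq0.
  apply: (mulfI a30); rewrite mulr0.
  have two0 : 1 + 1 = 0 :> F by rewrite addrr_pchar2.
  have xE : x = a * u by rewrite -uE mulrC divfK.
  have yE : y = a * u + a by rewrite -xE -aE addrCA subrr addr0.
  have := Hxy; rewrite xE yE !(exprD_binary cardF) !exprMn => /esym/eqP.
  rewrite -subr_eq0 (exprD_binary cardF _ _ 1) expn1 !exprMn => /eqP Ha.
  rewrite -[RHS]Ha /N; set V := u ^+ (2 ^ m); set A := a ^+ (2 ^ m).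
  have A0 : A != 0 by rewrite expf_neq0.
  by field; rewrite A0.
(* As w^4 = w, the value of [w ^+ (2 ^ i)] depends only on the parity of [i]. *)
have w4 c : w ^+ (2 ^ (c * 2)) = w.
  elim: c => [|c IHc]; first by rewrite expr1.
  by rewrite mulSn expnD exprM (_ : 2 ^ 2 = 3 + 1)%N // exprD w3 mul1r.
have wodd i : odd i -> w ^+ (2 ^ i) = w ^+ 2.
  move=> iodd; rewrite -[i]odd_double_half iodd -muln2 add1n expnSr exprM w4 //.
pose l := w ^+ 2.
have gq : gamma ^+ (2 ^ m) = gamma * w.
  by rewrite -wE -exprS -subSn ?expn_gt0 // subn1.
have lodd i : odd i -> l ^+ (2 ^ i) = w.
  by move=> iodd; rewrite /l exprAC wodd // -exprM (_ : 2 * 2 = 3 + 1)%N // exprD w3 mul1r.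
have t1 : abs_trace (m * 2) (l * (u ^+ 2 + u ^+ (2 ^ m))) = 0.
  have m0 := ext_degree_gt0.
  have lu i : (i <= m * 2)%N -> odd (m * 2 - i) ->
      abs_trace (m * 2) (l * u ^+ (2 ^ i)) = abs_trace (m * 2) (w * u).
    by move=> im iodd; rewrite abs_trace_shift // lodd.
  rewrite mulrDr (abs_traceD cardF) (lu 1) ?lu ?addrr_pchar2 //; lia.
(* Since l^q = w and gamma^q = gamma w, the product l gamma is fixed by conjugation, as is the norm
   [N]. *)
have t2 : abs_trace (m * 2) (l * (gamma / N)) = 0.
  apply: abs_trace_subfield; have Nq : N ^+ (2 ^ m) = N.
    by rewrite exprMn conjqK mulrC.
  by rewrite [LHS]exprMn (lodd m) // exprMn exprVn Nq gq /l expr2 -!mulrA [gamma * (w * _)]mulrCA.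
(* The conjugates of [l] alternate between w^2 and w, with w + w^2 = 1, so the trace is [m] times 1
   and [m] is odd. *)
have t3 : abs_trace (m * 2) l = 1.
  have l1 : w + w ^+ 2 = 1.
    have /eqP : (w - 1) * (1 + w + w ^+ 2) = 0.
      by rewrite -(subrr (w ^+ 3)) {2}w3; ring.
    rewrite mulf_eq0 subr_eq0 (negbTE w1) -addrA -GRing.subr_pchar2 // subr_eq0.
    by move=> /eqP.
  have trE c : abs_trace (c * 2) l = c%:R.
    elim: c => [|c IHc]; first exact: big_ord0.
    rewrite /abs_trace mulSn add2n !big_ord_recr /= -/(abs_trace _ _) IHc.
    rewrite (lodd (c * 2).+1) ?oddS ?oddM ?andbF //.
    by rewrite /l exprAC w4 -addrA [_ + w]addrC l1 natr1.
  rewrite trE -[X in X%:R]odd_double_half modd -muln2 natrD natrM (pcharf0 charF2).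
  by rewrite mulr0 addr0.
have := congr1 (fun z => abs_trace (m * 2) (l * z)) relation.
rewrite /= mulr0 abs_trace0 mulrDr (abs_traceD cardF) t1 add0r mulrDr mulr1.
by rewrite (abs_traceD cardF) t2 t3 addr0 => /eqP; rewrite oner_eq0.
Qed.

End QuadraticExtension.

(** * Elements of order 3, and exponents divided by their gcd *)

Lemma mul_order3P (F : finFieldType) (x : F) :
  reflect (x != 1 /\ x ^+ 3 = 1) (mul_order x == 3%N).
Proof.
rewrite /mul_order; case: (eqVneq x 0) => [->|x0].
  (* Zero receives the default order 1, in agreement with 0^3 != 1. *)
  rewrite /insubd insubN ?unitr0 //= order1; constructor=> -[_ /eqP].
  by rewrite expr0n eq_sym oner_eq0.
have ux : x \in GRing.unit by rewrite unitfE.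
have vx : val (insubd (1%g : {unit F}) x) = x by rewrite insubdK.
set y := insubd _ _ in vx *.
have y3 : (y ^+ 3 == 1)%g = (x ^+ 3 == 1).
  by rewrite -val_eqE /= FinRing.val_unitX vx.
have y1 : (y == 1)%g = (x == 1) by rewrite -val_eqE /= vx.
apply: (iffP eqP) => [o3|[x1 /eqP x3]].
  by split; [rewrite -y1 -order_eq1 o3 | apply/eqP; rewrite -y3 -[X in (_ ^+ X)%g]o3 expg_order].
have /primeP[_ /(_ #[y]%g)] : prime 3 by [].
by rewrite order_dvdn y3 x3 order_eq1 y1 (negbTE x1) => /(_ isT)/eqP.
Qed.

(** With a = 2 c, the factor 2 g comes out and c is coprime to [b]. This gives the exponent [g * 2]
    of the fixed field containing [l]. *)
Lemma gcdn_even_coprime a b g : ~~ odd a -> coprime a b ->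
  gcdn (a * g) (b * g * 2) = (g * 2)%N.
Proof.
move=> aev; rewrite -[a]odd_double_half (negbTE aev) -muln2 coprimeMl.
case/andP=> /eqP cab _.
by rewrite add0n -mulnA [(2 * g)%N]mulnC -mulnA -muln_gcdl cab mul1n.
Qed.

Lemma logn2_eq0 n : (0 < n)%N -> (logn 2 n == 0)%N = odd n.
Proof. by move=> n0; rewrite lognE n0 dvdn2; case: odd. Qed.

(** Since [m'] is odd, the valuations of [m] and [k] differ by that of [k'], so the case distinction
    becomes the parity of [k']. *)
Lemma reduced_exponents m k : (1 <= k <= m - 1)%N -> odd (m %/ gcdn m k) ->
  exists m' k' g, [/\ m = (m' * g)%N, k = (k' * g)%N, coprime k' m',
    (0 < g)%N & [/\ odd m', (0 < k')%N, (k' < m')%N &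
    (logn 2 m == logn 2 k) = odd k']].
Proof.
move=> kbnd modd; have g0 : (0 < gcdn m k)%N by rewrite gcdn_gt0; lia.
have mE := esym (divnK (dvdn_gcdl m k)); have kE := esym (divnK (dvdn_gcdr m k)).
have cop : (gcdn (k %/ gcdn m k) (m %/ gcdn m k) * gcdn m k = gcdn m k)%N.
  by rewrite muln_gcdl -mE -kE gcdnC.
move: (gcdn m k) (m %/ _)%N (k %/ _)%N g0 modd mE kE cop => g m' k' g0 modd mE kE cop.
have k'0 : (0 < k' < m')%N by nia.
have /andP[k'_gt0 k'_lt] := k'0.
exists m', k', g; split=> //.
  by rewrite /coprime -(eqn_pmul2r g0) mul1n cop.
split=> //; rewrite mE kE !lognM //; last by lia.
rewrite eqn_add2r -(logn2_eq0 k'_gt0) eq_sym.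
by have := logn2_eq0 (_ : 0 < m')%N; rewrite modd => /(_ _)/eqP-> //; lia.
Qed.

(** * The two shapes of [H] *)

Section Assembly.

Variables (F : finFieldType) (m' k' g : nat).
Let m := (m' * g)%N.
Let k := (k' * g)%N.
Hypotheses (cardF : #|F| = (2 ^ (m * 2))%N) (coprime_km : coprime k' m').
Hypotheses (g_gt0 : (0 < g)%N) (odd_m : odd m').
Hypotheses (k_gt0 : (0 < k')%N) (k_lt : (k' < m')%N).

Let km2 : (k <= m * 2)%N. Proof. by rewrite /k /m; nia. Qed.
Let g_dvd : (g %| m)%N. Proof. exact: dvdn_mull. Qed.
Let odd_quo : odd (m %/ g). Proof. by rewrite mulnK. Qed.

Let norm1 (alpha : F) : alpha != 0 ->
  alpha ^+ (2 ^ m - 1) * alpha ^+ (2 ^ m - 1) ^+ (2 ^ m) = 1.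
Proof.
move=> al0; rewrite -exprS -exprM; apply: (mulfI al0).
rewrite mulr1 -exprS -[RHS](expr_card_binary cardF) expnM.
by congr (_ ^+ _); have := expn_gt0 2 m; nia.
Qed.

Let conj_eq0 (x : F) : x ^+ (2 ^ m) = 0 -> x = 0.
Proof. by move/eqP; rewrite expf_eq0 => /andP[_ /eqP]. Qed.

Lemma injective_conj_case (gamma delta : F) : odd k' ->
  (gamma, delta) <> (0, 0) ->
  injective (fun x : F =>
    x ^+ (2 ^ k) * x ^+ (2 ^ m) + gamma * x + delta * x ^+ (2 ^ m)) ->
  [/\ k = 1%N, delta = 0 & gamma ^+ (2 ^ m - 1) != 1 /\
      gamma ^+ (2 ^ m - 1) ^+ 3 = 1].
Proof.
move=> odd_k gd0 injH.
have gcdE : gcdn (m * 2 - m + k) (m * 2) = (g * 2)%N.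
  have -> : (m * 2 - m + k = (m' + k') * g)%N by rewrite /m /k; lia.
  rewrite gcdn_even_coprime ?oddD ?odd_m ?odd_k //.
  by rewrite /coprime gcdnC gcdnDl gcdnC.
have jm : (m <= m * 2)%N by lia.
have Q2 : (2 ^ g * 2 ^ g * 2 ^ k <= 2 ^ m)%N.
  rewrite -!expnD leq_exp2l // /m /k.
  (* Both [m'] and [k'] are odd, so m' >= k' + 2, which leaves room for the degree Q (G + 1). *)
  have mN : m' != k'.+1 by apply: contraTneq odd_m => ->; rewrite /= odd_k.
  by have : (k' + 2 <= m')%N; [lia | nia].
have G2 : (2 <= 2 ^ g)%N by rewrite -{1}(expn1 2) leq_exp2l.
have GQ : (2 ^ g <= 2 ^ k)%N by rewrite leq_exp2l // /k; nia.
have [||||d0 gN] := norm1_power_relation cardF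
  (a := gamma ^+ (2 ^ m)) (b := delta ^+ (2 ^ m)) (c := gamma) (d := delta)
  (n := (2 ^ k - 1) * (2 ^ g + 1)) (M := 2 ^ g + 1); [nia|nia|nia| |].
  move=> alpha al0 v.
  have [_ ->] := norm1_relation cardF km2 jm g_dvd odd_quo gcdE (fun s e => e) injH al0.
  rewrite -/v exprM -exprMn; congr (_ ^+ _).
  (* Norm 1 turns v^Q v^q into v^(Q-1). *)
  rewrite -[in LHS](@subnK 1 (2 ^ k)) ?expn_gt0 // exprD expr1 -mulrA norm1 //.
  by rewrite mulr1; ring.
have {}d0 := conj_eq0 d0.
have gam0 : gamma != 0 by apply/eqP => g0; apply: gd0; rewrite g0 d0.
have k1 : k = 1%N.
  (* (Q - 1)(G + 1) = G + 1 forces Q = 2. *)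
  have := gN d0 (expf_neq0 _ gam0) => nE.
  have /eqP : (2 ^ k = 2 ^ 1)%N by nia.
  by rewrite eqn_exp2l // => /eqP.
(* At alpha = 1 the ratio is [gamma], and k = 1 gives g = 1, so G + 1 = 3. *)
split=> //; have := injective_ratio cardF km2 jm g_dvd odd_quo gcdE (fun s e => e) injH (oner_neq0 F).
rewrite d0 mul0r addr0 !expr1n !mulr1 divr1 => /(_ gam0).
have -> : g = 1%N by move: k1; rewrite /k; case: (g) g_gt0 => [|[|]] //; nia.
by rewrite exprM.
Qed.

Lemma injective_plain_case (gamma delta : F) : ~~ odd k' ->
  (gamma, delta) <> (0, 0) ->
  ~ injective (fun x : F =>
      x ^+ (2 ^ k) * x ^+ (2 ^ 0) + gamma * x + delta * x ^+ (2 ^ m)).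
Proof.
move=> even_k gd0 injH.
have gcdE : gcdn (m * 2 - 0 + k) (m * 2) = (g * 2)%N.
  have -> : (m * 2 - 0 + k = (m' * 2 + k') * g)%N by rewrite /m /k; lia.
  rewrite gcdn_even_coprime ?oddD ?oddM ?andbF //.
  by rewrite /coprime gcdnC mulnC gcdnMDl gcdnC.
have rel := norm1_relation cardF km2 (leq0n _) g_dvd odd_quo gcdE (fun s _ => expr1 s) injH.
have G2 : (2 <= 2 ^ g)%N by rewrite -{1}(expn1 2) leq_exp2l.
have k2 : (2 <= k')%N by case: (k') k_gt0 even_k => [|[|]].
have GQ : (2 ^ g * 2 ^ g <= 2 ^ k)%N by rewrite -expnD leq_exp2l // /k; nia.
(* As [k'] is even and [m'] odd, m' != k' + 1 means m' >= k' + 3, which leaves room for the degree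
   (Q + 2)(G + 1). *)
have [mE|mN] := eqVneq m' k'.+1; last first.
  have Q2 : (2 ^ g * (2 ^ g * 2 ^ g) * 2 ^ k <= 2 ^ m)%N.
    rewrite -!expnD leq_exp2l // /m /k.
    have mN2 : m' != k'.+2 by apply: contraTneq odd_m => ->; rewrite /= negbK.
    by have : (k' + 3 <= m')%N; [lia | nia].
  have [||||d0 gN] := norm1_power_relation cardF
    (a := gamma ^+ (2 ^ m)) (b := delta ^+ (2 ^ m)) (c := gamma) (d := delta)
    (n := (2 ^ k + 1) * (2 ^ g + 1)) (M := 2 ^ g + 1); [nia|nia|nia| |].
    move=> alpha al0 v; have [_ ->] := rel _ al0.
    by rewrite -/v exprM -exprMn; congr (_ ^+ _); rewrite exprD; ring.
  have {}d0 := conj_eq0 d0.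
  have gam0 : gamma != 0 by apply/eqP => g0; apply: gd0; rewrite g0 d0.
  have := gN d0 (expf_neq0 _ gam0); nia.
(* Now q = Q G is below that degree, so the relation is first reduced by v^(q+1) = 1. *)
have mG : (2 ^ m = 2 ^ k * 2 ^ g)%N by rewrite -expnD /m /k mE; congr (_ ^ _)%N; lia.
have [||d0 gN] := norm1_reduced_relation cardF (a := gamma ^+ (2 ^ m))
  (b := delta ^+ (2 ^ m)) (c := gamma) (d := delta) (Q := 2 ^ k) g_gt0.
- by rewrite mG; nia.
- move=> alpha al0 v.
  move: (rel _ al0); cbv zeta; rewrite -/v expn0 expr1 -exprSr.
  set r := _ + delta ^+ _; set p := _ * v ^+ _ => -[pr0 prG].
  have vG : v ^+ (2 ^ k).+1 ^+ (2 ^ g) = v ^+ (2 ^ g - 1).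
    rewrite -exprM mulSn -mG -[in LHS](@subnK 1 (2 ^ g)) ?expn_gt0 //.
    by rewrite -addnA exprD add1n exprS norm1 // mulr1.
  have pG : p ^+ (2 ^ g) = (delta ^+ (2 ^ g) * v ^+ (2 ^ g) + gamma ^+ (2 ^ g)) * v ^+ (2 ^ g - 1).
    by rewrite exprMn vG (exprD_binary cardF) exprMn addrC.
  rewrite -pG -/p -/r; clear pG; clearbody p r.
  have charF2 := pchar_binary cardF.
  have [prE|prN] := eqVneq p r.
    have p0 := pr0 prE; rewrite -prE p0 addr0 !expr0n expn_eq0 /= mul0r addr0 //.
  have pr : p + r != 0 by rewrite -(GRing.subr_pchar2 charF2) subr_eq0.
  (* In characteristic 2, multiplication by [p + r] turns the expression into p^(G+1) + r^(G+1),
     which is 0. *)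
  apply: (mulIf pr); rewrite mul0r mulrDl -[_ * _ ^+ _ * _]mulrA -exprSr.
  rewrite -subSn ?expn_gt0 // subn1 /= (exprD_binary cardF) !mulrDr.
  move: prG; rewrite !addn1 !exprS => ->.
  transitivity ((1 + 1) * (p * p ^+ (2 ^ g) + r * p ^+ (2 ^ g))); first by ring.
  by rewrite addrr_pchar2 // mul0r.
have {}d0 := conj_eq0 d0.
by apply: gd0; rewrite d0 (gN d0).
Qed.

End Assembly.

Theorem proposition3p4 (m k : nat) (F : finFieldType) (gamma delta : F)
    (hk : (1 <= k <= m - 1)%N)
    (hodd : odd (m %/ gcdn m k))
    (hF : #|F| = ((2 ^ m) ^ 2)%N)
    (hgd : (gamma, delta) <> (0, 0)) :
  let H := Hmap m k gamma delta in
  let exceptional :=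
    [/\ k = 1%N, delta = 0 & mul_order (gamma ^+ (2 ^ m - 1)) = 3%N] in
  (logn 2 m = logn 2 k ->
     (~ exceptional -> ~ bijective H) /\ (exceptional -> bijective H))
  /\ ((logn 2 m < logn 2 k)%N -> ~ bijective H).
Proof.
move=> H exceptional.
have cardF : #|F| = (2 ^ (m * 2))%N by rewrite hF -expnM.
have [m' [k' [g [mE kE cop g0 [oddm k0 km vE]]]]] := reduced_exponents hk hodd.
have injE f : bijective H -> H =1 f -> injective f.
  by move=> /bij_inj Hinj Hf; apply: eq_inj Hinj Hf.
split=> [veq|vlt].
  have Heq : H =1 fun x => x ^+ (2 ^ k) * x ^+ (2 ^ m) + gamma * x + delta * x ^+ (2 ^ m).
    by move=> x; rewrite /H /Hmap veq eqxx.
  split=> [nexc /injE/(_ Heq)|[k1 d0 /eqP/mul_order3P[w1 w3]]].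
    rewrite mE kE => injH; apply: nexc.
    have odd_k : odd k' by rewrite -vE veq.
    rewrite mE in cardF.
    have [k1 d0 w] := injective_conj_case cardF cop g0 oddm k0 km odd_k hgd injH.
    by split=> //; [rewrite kE | apply/eqP/mul_order3P; rewrite mE].
  apply: injF_bij; apply: (eq_inj (cubic_exceptional_injective cardF _ w1 _)).
  (* Equal valuations with k = 1 make [m] odd. *)
  - by rewrite -logn2_eq0 ?veq ?k1 //; lia.
  - by rewrite exprM.
  - by move=> x; rewrite Heq k1 d0 mul0r addr0.
(* The factor [x ^+ (2 ^ 0)] gives x^(Q+1) the shape x^Q x^e shared by both cases. *)
have Heq : H =1 fun x => x ^+ (2 ^ k) * x ^+ (2 ^ 0) + gamma * x + delta * x ^+ (2 ^ m).
  by move=> x; rewrite /H /Hmap /qconj ltn_eqF // exprSr.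
move=> /injE/(_ Heq); rewrite mE kE; rewrite mE in cardF.
apply: injective_plain_case => //.
by rewrite -vE ltn_eqF.
Qed.
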